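(* On an $m \times n$ one-way street network where $m, n$ are even numbers, as long as $$\frac{l_p}{v} \le \frac{1}{2}\hat{t} \qquad\text{and}\qquad t_c = a\hat{t}, \quad a \in \mathbb{N}^+,$$ we can set the entry times of virtual platoons on horizontal streets to be $k\hat{t}$, $k \in \mathbb{N}$, and on vertical streets to be $(k+\frac{1}{2})\hat{t}$, $k \in \mathbb{N}$, to avoid collisions at crossroads.
   Context: An $m \times n$ one-way street network is a grid network with $m$ horizontal and $n$ vertical one-way streets, where within each parallel group the directions of the streets alternate. A crossroads is the intersection of two perpendicular one-way streets. Blocks are identical, i.e., the intervals between neighboring parallel streets are the same. Vehicles come into a street from outside the network at the street's entrance. A virtual platoon is a reserved time-space occupation with a predetermined trajectory along a street (it may or may not contain vehicles). It is formed at the entrance of a street at its entry time and moves forward along that street, at constant speed, to the exit of the same street. Notation: $\hat{t}$ is the time between two virtual platoons consecutively formed and allowed to enter the network on the same street; $l_p$ is the maximum length of a virtual platoon; $v$ is the constant platoon speed; $t_c$ is the travel time required for a virtual platoon to pass through a segment between two consecutive crossroads. Avoiding collisions at crossroads means that virtual platoons arriving at a crossroads from different directions (one on the horizontal street, one on the vertical street) do not collide there. $\mathbb{N}$ is the set of non-negative integers and $\mathbb{N}^+$ the set of positive integers. *)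

(* Defs.v *)
From HB Require Import structures.
From mathcomp Require Import all_boot all_order all_algebra.

Set Implicit Arguments.
Unset Strict Implicit.
Unset Printing Implicit Defensive.

Import Order.TTheory GRing.Theory Num.Theory.

Local Open Scope ring_scope.

Definition alternating (p : nat) (dir : 'I_p -> bool) : Prop :=
  forall i j : 'I_p, j = i.+1 :> nat -> dir j = ~~ dir i.

(* Direction [true] means travel towards increasing coordinates. The streets  *)
(* extend beyond the outermost crossroads by a common length [approach] to    *)
(* their entrances and exits; 0 puts these at the outermost crossroads.       *)
Record network (R : realFieldType) (m n : nat) := Network {
  block : R;
  approach : R;
  hdir : 'I_m -> bool;
  vdir : 'I_n -> bool;
  block_gt0 : 0 < block;
  approach_ge0 : 0 <= approach;
  hdir_alternating : alternating hdir;
  vdir_alternating : alternating vdir }.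

Inductive street (m n : nat) : Type :=
  | Horizontal of 'I_m
  | Vertical of 'I_n.

Arguments Horizontal {m n} i.
Arguments Vertical {m n} j.

Section Network.

Variables (R : realFieldType) (m n : nat) (N : network R m n).

Definition crossroads (i : 'I_m) (j : 'I_n) : R * R :=
  (j%:R * block N, i%:R * block N).

Definition street_length (s : street m n) : R :=
  match s with
  | Horizontal _ => n.-1%:R * block N + 2 * approach N
  | Vertical _ => m.-1%:R * block N + 2 * approach N
  end.

(* The coordinate reached, on a line of [p] crossroads, after travelling a    *)
(* distance [d] from the entrance.                                            *)
Definition coordinate (p : nat) (dir : bool) (d : R) : R :=
  if dir then - approach N + d
  else p.-1%:R * block N + approach N - d.

Definition street_point (s : street m n) (d : R) : R * R :=
  match s with
  | Horizontal i => (coordinate n (hdir N i) d, i%:R * block N)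
  | Vertical j => (j%:R * block N, coordinate m (vdir N j) d)
  end.

Definition segment_time (v : R) : R := block N / v.

(* [entry] is the time at which the front of the platoon is at the entrance.  *)
Record platoon := Platoon {
  on_street : street m n;
  entry : R;
  len : R }.

Definition front (v : R) (P : platoon) (t : R) : R := v * (t - entry P).

(* The platoon includes its front but not its rear end, so that two platoons  *)
(* passing a point in immediate succession do not collide there.              *)
Definition occupies (v : R) (P : platoon) (t : R) (x : R * R) : Prop :=
  exists d : R,
    [/\ 0 <= d <= street_length (on_street P),
        front v P t - len P < d <= front v P t
      & x = street_point (on_street P) d].

(* [T s k] is the entry time of the [k]-th platoon of street [s]. *)
Definition schedule := street m n -> nat -> R.

Definition has_headway (T : schedule) (that : R) : Prop :=
  forall (s : street m n) (k : nat), T s k.+1 - T s k = that.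

Definition scheduled (T : schedule) (lp : R) (P : platoon) : Prop :=
  (exists k : nat, entry P = T (on_street P) k) /\ 0 < len P <= lp.

Definition avoids_collisions (T : schedule) (v lp : R) : Prop :=
  forall (i : 'I_m) (j : 'I_n) (P Q : platoon),
    on_street P = Horizontal i -> on_street Q = Vertical j ->
    scheduled T lp P -> scheduled T lp Q ->
    forall t : R, ~ (occupies v P t (crossroads i j) /\
                     occupies v Q t (crossroads i j)).

End Network.

(* Main.v *)
(* Every distance from an entrance to a crossroads is the common approach plus *)
(* a whole number of blocks, and each block takes a whole number of headways.  *)
(* Hence, up to a common shift of time, in units of the headway, horizontal    *)
(* platoons occupy a crossroads only during intervals [K, K + 1/2) and         *)
(* vertical ones only during [K + 1/2, K + 1), with [K] an integer.            *)
Require Import Defs.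
From mathcomp Require Import all_boot all_order all_algebra.
From mathcomp Require Import ring lra.

Set Implicit Arguments.
Unset Strict Implicit.
Unset Printing Implicit Defensive.

Import Order.TTheory GRing.Theory Num.Theory.

Local Open Scope ring_scope.

(** The bound on [lp] limits each stay at a crossroads to half a headway. [occupies_crossroads]
    supplies the whole number of blocks, [half_slots_disjoint] the contradiction. *)

Lemma coordinate_crossing (R : realFieldType) (m n : nat) (N : network R m n)
    (p : nat) (dir : bool) (d : R) (j : 'I_p) :
  j%:R * block N = coordinate N p dir d ->
  exists c : nat, d = approach N + c%:R * block N.
Proof.
rewrite /coordinate; case: dir => eq_jd; first by exists j; lra.
(* Blocks are counted from the far end; [j < p] makes the truncated subtraction exact. *)
exists (p.-1 - j)%N; rewrite natrB; first lra.
by rewrite -ltnS (ltn_predK (ltn_ord j)).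
Qed.

Lemma occupies_crossroads (R : realFieldType) (m n : nat) (N : network R m n)
    (v t : R) (P : platoon R m n) (i : 'I_m) (j : 'I_n) :
  on_street P = Horizontal i \/ on_street P = Vertical j ->
  occupies N v P t (crossroads N i j) ->
  exists c : nat,
    front v P t - len P < approach N + c%:R * block N <= front v P t.
Proof.
move=> onP [d [_ d_bounds x_eq]].
have [c d_eq] : exists c : nat, d = approach N + c%:R * block N.
  case: onP x_eq => onP; rewrite onP /street_point /crossroads.
    by case=> /coordinate_crossing.
  by case=> /coordinate_crossing.
by exists c; rewrite -d_eq.
Qed.

(** A common [u] would force both [K < L + 1] and [L < K]. *)
Lemma half_slots_disjoint (R : realFieldType) (x u : R) (K L : nat) :
  0 < x -> K%:R * x <= u < (K%:R + 1 / 2) * x ->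
  ~ ((L%:R + 1 / 2) * x <= u < (L%:R + 1) * x).
Proof.
move=> x_gt0 /andP[leKu ltuK] /andP[leLu ltuL].
have := le_lt_trans leKu ltuL.
rewrite ltr_pM2r // natr1 ltr_nat ltnS leqNgt => /negP; apply.
by have := le_lt_trans leLu ltuK; rewrite ltr_pM2r // ltrD2r ltr_nat.
Qed.

Theorem proposition2 (R : realFieldType) (m n : nat) (N : network R m n)
    (v lp that : R) (a : nat)
    (m_even : ~~ odd m) (n_even : ~~ odd n)
    (v_gt0 : 0 < v) (lp_gt0 : 0 < lp) (that_gt0 : 0 < that)
    (platoon_short : lp / v <= 1 / 2 * that)
    (a_gt0 : (0 < a)%N) (segment_timeE : segment_time N v = a%:R * that) :
  exists T : schedule R m n,
    [/\ forall (i : 'I_m) (k : nat), T (Horizontal i) k = k%:R * that,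
        forall (j : 'I_n) (k : nat), T (Vertical j) k = (k%:R + 1 / 2) * that,
        has_headway T that
      & avoids_collisions N T v lp].
Proof.
exists (fun s k => if s is Horizontal _ then k%:R * that
                   else (k%:R + 1 / 2) * that).
split=> // [s k|i j P Q onP onQ [[k entryP] /andP[_ lenP]]
  [[l entryQ] /andP[_ lenQ]] t [occP occQ]].
  by case: s => _; rewrite -[k.+1%:R]natr1; ring.
rewrite onP in entryP; rewrite onQ in entryQ.
have [c /andP[]] := occupies_crossroads (or_introl onP) occP.
have [c' /andP[]] := occupies_crossroads (or_intror onQ) occQ.
have -> : block N = a%:R * (v * that).
  by rewrite mulrCA -segment_timeE mulrC divfK ?gt_eqF.
have lp_le : lp <= 1 / 2 * (v * that).
  by rewrite [v * that]mulrC mulrA -ler_pdivrMr.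
rewrite /front entryP entryQ !mulrBr [v * (k%:R * _)]mulrCA.
rewrite [v * (_ * that)]mulrCA => Q_rear Q_front P_rear P_front.
(* Times are scaled by [v], so a headway becomes [v * that]. Travelling [c] blocks delays platoon
   [k] by [c * a] headways. *)
apply: (@half_slots_disjoint _ (v * that) (v * t - approach N)
          (k + c * a) (l + c' * a)); rewrite ?mulr_gt0 // !natrD !natrM;
  by apply/andP; split; lra.
Qed.
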